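(* Let $\sigma>0$, let $F:\mathcal{P}(\mathbb{R}^d)\to\mathbb{R}$ admit first and second order flat derivatives $\frac{\delta F}{\delta m}$ and $\frac{\delta^2 F}{\delta m^2}$, and suppose: (i) $F$ is convex, i.e. $F(m)-F(m')\le\int_{\mathbb{R}^d}\frac{\delta F}{\delta m}(m,x)(m-m')(dx)$ for all $m,m'\in\mathcal{P}(\mathbb{R}^d)$; (ii) there is $C>0$ with $\left|\frac{\delta F}{\delta m}(m,x)\right|\le C$ for all $m\in\mathcal{P}(\mathbb{R}^d)$, $x\in\mathbb{R}^d$; (iii) there is $C_2>0$ with $\left|\frac{\delta^2 F}{\delta m^2}(m,x,y)\right|\le C_2$ for all $m\in\mathcal{P}(\mathbb{R}^d)$, $x,y\in\mathbb{R}^d$. Let $\pi(dx)\propto\exp\left(-\frac{2}{\sigma^2}U(x)\right)dx$ be an absolutely continuous probability measure with potential $U:\mathbb{R}^d\to\mathbb{R}$, and let $m_0\in\mathcal{P}(\mathbb{R}^d)$ be absolutely continuous and such that, for some constant $R>1$, $\sup_{x\in\mathbb{R}^d}\frac{m_0(x)}{\pi(x)}\le R$. Let $(m_t)_{t\ge0}$ be the unique solution, with initial condition $m_0$, of $$\partial_t m_t(x)=-\left(\frac{\delta F}{\delta m}(m_t,x)+\frac{\sigma^2}{2}\log\left(\frac{m_t(x)}{\pi(x)}\right)-\frac{\sigma^2}{2}\operatorname{KL}(m_t|\pi)\right)m_t(x),$$ and let $V^\sigma(m)=F(m)+\frac{\sigma^2}{2}\operatorname{KL}(m|\pi)$. Then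 the function $t\mapsto V^\sigma(m_t)$ is differentiable and $$\partial_tV^\sigma(m_t)=-\int_{\mathbb{R}^d}\left|\frac{\delta F}{\delta m}(m_t,x)+\frac{\sigma^2}{2}\log\left(\frac{m_t(x)}{\pi(x)}\right)-\frac{\sigma^2}{2}\operatorname{KL}(m_t|\pi)\right|^2m_t(x)\,dx.$$
   Context: $\mathcal{P}(\mathbb{R}^d)$ is the space of Borel probability measures on $\mathbb{R}^d$; an absolutely continuous (with respect to Lebesgue measure) probability measure $m$ is identified with its density $x\mapsto m(x)$. KL-divergence: $\operatorname{KL}(m|\pi)=\int_{\mathbb{R}^d}\log\left(\frac{m(x)}{\pi(x)}\right)m(x)\,dx$ if $m$ is absolutely continuous with respect to $\pi$, and $+\infty$ otherwise. Flat derivative: $G:\mathcal{P}(\mathbb{R}^d)\to\mathbb{R}$ admits a (first order) flat derivative if there is a functional $\frac{\delta G}{\delta m}:\mathcal{P}(\mathbb{R}^d)\times\mathbb{R}^d\to\mathbb{R}$ such that (1) for every $a\in\mathbb{R}^d$, $m\mapsto\frac{\delta G}{\delta m}(m,a)$ is continuous (for the weak topology); (2) for every $m$, $a\mapsto\frac{\delta G}{\delta m}(m,a)$ is bounded; (3) for all $m,m'\in\mathcal{P}(\mathbb{R}^d)$, $G(m')-G(m)=\int_0^1\int_{\mathbb{R}^d}\frac{\delta G}{\delta m}(m+\lambda(m'-m),a)(m'-m)(da)\,d\lambda$. It is defined only up to an additive constant (in $a$), and is always normalized by $\int_{\mathbb{R}^d}\frac{\delta G}{\delta m}(m,x)\,m(dx)=0$.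 $F$ admits a second order flat derivative $\frac{\delta^2F}{\delta m^2}:\mathcal{P}(\mathbb{R}^d)\times\mathbb{R}^d\times\mathbb{R}^d\to\mathbb{R}$ if for each $a\in\mathbb{R}^d$ the functional $m\mapsto\frac{\delta F}{\delta m}(m,a)$ admits a flat derivative $\frac{\delta^2F}{\delta m^2}(m,\cdot,a)$; so $\frac{\delta F}{\delta m}(m',a)-\frac{\delta F}{\delta m}(m,a)=\int_0^1\int_{\mathbb{R}^d}\frac{\delta^2F}{\delta m^2}(m+\lambda(m'-m),a',a)(m'-m)(da')\,d\lambda$. A solution $(m_t)_{t\ge0}$ is a family of absolutely continuous probability measures, equal to $m_0$ at $t=0$, whose densities satisfy the equation for $t\ge0$ and $x\in\mathbb{R}^d$ (in particular $\operatorname{KL}(m_t|\pi)<\infty$). Under the stated hypotheses the paper establishes that such a solution exists and is unique. The expressions $s\log s$ and $s(\log s)^2$ are read as $0$ at $s=0$. *)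

(* Defs.v *)
From HB Require Import structures.
From mathcomp Require Import all_boot all_order all_algebra.
From mathcomp Require Import all_classical all_reals all_analysis.
From mathcomp Require Import measurable_realfun.

Set Implicit Arguments.
Unset Strict Implicit.
Unset Printing Implicit Defensive.

Import Order.TTheory GRing.Theory Num.Theory.
Import numFieldNormedType.Exports.

Local Open Scope classical_set_scope.
Local Open Scope ring_scope.

(* R^d with its Borel sigma-algebra: row vectors, sigma-algebra generated by
   the open sets. *)
Definition Rd (R : realType) (d : nat) :=
  g_sigma_algebraType (@open 'rV[R]_d).

Section borel_Rd.
Context {R : realType}.

Lemma measurable_coord d (i : 'I_d) :
  measurable_fun [set: Rd R d] (fun x : Rd R d => (x : 'rV[R]_d) ord0 i).
Proof.
apply: (measurability _ (measurable_realfun.RGenOpens.measurableE R)).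
move=> _ [_ [a [b ->] <-]]; rewrite setTI.
apply: sub_sigma_algebra.
have /continuousP := @coord_continuous R 1 d ord0 i.
by apply; exact: interval_open.
Qed.

Lemma measurable_to_Rd d disp (T : measurableType disp) (f : T -> Rd R d) :
  (forall i, measurable_fun [set: T] (fun x => (f x : 'rV[R]_d) ord0 i)) ->
  measurable_fun [set: T] f.
Proof.
move=> mf; apply: (@measurability _ _ T (Rd R d) setT f (@open 'rV[R]_d)) => //.
move=> _ [U oU <-]; rewrite setTI.
pose box (ab : 'rV[rat]_d * 'rV[rat]_d) : set 'rV[R]_d :=
  [set v | forall i, v ord0 i \in `]ratr (ab.1 ord0 i), ratr (ab.2 ord0 i)[].
have -> : f @^-1` U = \bigcup_(ab : 'rV[rat]_d * 'rV[rat]_d)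
    (if pselect (box ab `<=` U) then f @^-1` box ab else set0).
  apply/seteqP; split => [x /= Ux|x [ab _]]; last first.
    by case: pselect => //= bU; exact: bU.
  have /nbhs_ballP[e /= e0 eU] : nbhs (f x : 'rV[R]_d) U.
    exact: open_nbhs_nbhs.
  have lo i : exists q : rat, ratr q \in `](f x : 'rV[R]_d) ord0 i - e,
                                   (f x : 'rV[R]_d) ord0 i[.
    by apply: rat_in_itvoo; rewrite ltrBlDr ltrDl.
  have hi i : exists q : rat, ratr q \in `](f x : 'rV[R]_d) ord0 i,
                                   (f x : 'rV[R]_d) ord0 i + e[.
    by apply: rat_in_itvoo; rewrite ltrDl.
  exists (\row_i sval (cid (lo i)), \row_i sval (cid (hi i))) => //.
  case: pselect => /= [_|[]].
    move=> i; rewrite /= !mxE in_itv/=.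
    have := svalP (cid (lo i)); have := svalP (cid (hi i)).
    by rewrite !in_itv/= => /andP[-> _] /andP[_ ->].
  move=> v bv; apply: eU; split => // i j.
  rewrite (ord1 i) /ball/= ltr_distlC.
  have := bv j; rewrite /= !mxE in_itv/= => /andP[lv vh].
  have := svalP (cid (lo j)); have := svalP (cid (hi j)).
  rewrite !in_itv/= => /andP[_ he] /andP[el _].
  by rewrite (lt_trans el lv) (lt_trans vh he).
apply: countable_bigcupT_measurable => [|ab]; first exact: countableP.
case: pselect => [?|?] /=; last exact: measurable0.
have -> : f @^-1` box ab = \bigcap_(i in [set: 'I_d])
    ((fun x => (f x : 'rV[R]_d) ord0 i) @^-1`
      `]ratr (ab.1 ord0 i), ratr (ab.2 ord0 i)[%classic).
  by apply/seteqP; split => x /= bx i; have := bx i => //; exact.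
apply: fin_bigcap_measurable => // i _.
by rewrite -[X in measurable X]setTI; apply: mf.
Qed.

Definition consRd d (p : R * Rd R d) : Rd R d.+1 :=
  (\row_i if unlift ord0 i is Some j then (p.2 : 'rV[R]_d) ord0 j else p.1)
    : 'rV[R]_d.+1.

Definition unconsRd d (v : Rd R d.+1) : R * Rd R d :=
  ((v : 'rV[R]_d.+1) ord0 ord0,
   (\row_i (v : 'rV[R]_d.+1) ord0 (lift ord0 i)) : 'rV[R]_d).

Lemma consRdK d : cancel (@consRd d) (@unconsRd d).
Proof.
move=> [x v]; rewrite /unconsRd /consRd; congr pair.
  by rewrite mxE unlift_none.
by apply/rowP => i; rewrite !mxE liftK.
Qed.

Lemma unconsRdK d : cancel (@unconsRd d) (@consRd d).
Proof.
move=> v; apply/rowP => i; rewrite /consRd /unconsRd mxE.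
by case: unliftP => [j ->|->] //=; rewrite mxE.
Qed.

Lemma measurable_consRd d :
  measurable_fun [set: measurableTypeR R * Rd R d] (@consRd d).
Proof.
apply: measurable_to_Rd => i; rewrite /consRd.
under eq_fun do rewrite mxE.
case: (unlift ord0 i) => [j|]; last exact: measurable_fst.
apply: (measurableT_comp (measurable_coord j)); exact: measurable_snd.
Qed.

Lemma measurable_unconsRd d :
  measurable_fun [set: Rd R d.+1]
    (@unconsRd d : _ -> measurableTypeR R * Rd R d).
Proof.
apply/measurable_fun_pairP; split; first exact: measurable_coord.
apply: measurable_to_Rd => i /=; under eq_fun do rewrite mxE.
exact: measurable_coord.
Qed.

Section step.
Variables (d : nat) (mu : {sigma_finite_measure set (Rd R d) -> \bar R}).

Definition leb_step : set (Rd R d.+1) -> \bar R :=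
  pushforward (@lebesgue_measure R \x mu)%E (@consRd d).


Let leb_step0 : leb_step set0 = 0%E.
Proof. by rewrite /leb_step /pushforward preimage_set0 measure0. Qed.

Let leb_step_ge0 A : (0 <= leb_step A)%E.
Proof.
rewrite /leb_step /pushforward; exact: measure_ge0.
Qed.

Let leb_step_sigma_additive : semi_sigma_additive leb_step.
Proof.
move=> F mF tF mUF; rewrite /leb_step /pushforward preimage_bigcup.
apply: measure_semi_sigma_additive.
- by move=> n; rewrite -[X in measurable X]setTI; exact: measurable_consRd.
- apply/trivIsetP => /= i j _ _ ij; rewrite -preimage_setI.
  by move/trivIsetP : tF => /(_ _ _ _ _ ij) ->//; rewrite preimage_set0.
- rewrite -preimage_bigcup -[X in measurable X]setTI.
  exact: measurable_consRd.
Qed.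

HB.instance Definition _ := isMeasure.Build _ _ _ leb_step
  leb_step0 leb_step_ge0 leb_step_sigma_additive.

Let leb_step_sigma_finite : sigma_finite setT leb_step.
Proof.
have /sigma_finiteP[F [FT ndF Foo]] := sigma_finiteT (@lebesgue_measure R).
have /sigma_finiteP[G [GT ndG Goo]] := sigma_finiteT mu.
exists (fun n => @unconsRd d @^-1` (F n `*` G n)).
  rewrite -preimage_bigcup; apply/esym; rewrite -[RHS](preimage_setT (@unconsRd d)).
  congr (_ @^-1` _); rewrite -subTset => -[x y] _.
  have [n _ Fnx] : (\bigcup_i F i) x by rewrite -FT.
  have [k _ Gky] : (\bigcup_i G i) y by rewrite -GT.
  exists (maxn n k) => //; split => /=.
  - by move: x Fnx; exact/subsetPset/ndF/leq_maxl.
  - by move: y Gky; exact/subsetPset/ndG/leq_maxr.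
move=> n; have [? ?] := Foo n; have [? ?] := Goo n; split.
  rewrite -[X in measurable X]setTI; apply: measurable_unconsRd => //.
  exact: measurableX.
rewrite /leb_step /pushforward -comp_preimage.
rewrite (_ : _ \o _ = id); last by apply/funext => p; exact: consRdK.
by rewrite preimage_id product_measure1E// lte_mul_pinfty// ge0_fin_numE.
Qed.

HB.instance Definition _ := Measure_isSigmaFinite.Build _ _ _ leb_step
  leb_step_sigma_finite.

End step.

(* Lebesgue measure on R^d, as the d-fold product of Lebesgue measure on R;
   lebesgue_Rd_box below gives its value on rectangles. *)
Fixpoint leb_rec (d : nat) : {sigma_finite_measure set (Rd R d) -> \bar R} :=
  if d is d'.+1 then leb_step (leb_rec d')
  else \d_((0 : 'rV[R]_0) : Rd R 0).

End borel_Rd.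

Definition lebesgue_Rd {R : realType} {d : nat} : set (Rd R d) -> \bar R :=
  leb_rec d.

HB.instance Definition _ (R : realType) (d : nat) :=
  SigmaFiniteMeasure.copy (@lebesgue_Rd R d) (@leb_rec R d).

Lemma lebesgue_Rd_box (R : realType) (d : nat) (A : 'I_d -> set R) :
  (forall i, measurable (A i)) ->
  lebesgue_Rd [set v : Rd R d | forall i, A i ((v : 'rV[R]_d) ord0 i)] =
  (\prod_(i < d) lebesgue_measure (A i))%E.
Proof.
elim: d A => [|d IH] A mA.
  rewrite big_ord0 /lebesgue_Rd/= diracE mem_set// => -[].
  by [].
have mB : measurable
    [set v : Rd R d | forall i, A (lift ord0 i) ((v : 'rV[R]_d) ord0 i)].
  rewrite (_ : [set v | _] = \bigcap_(i in [set: 'I_d])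
      ((fun v : Rd R d => (v : 'rV[R]_d) ord0 i) @^-1` A (lift ord0 i))).
    apply: fin_bigcap_measurable => // i _.
    by rewrite -[X in measurable X]setTI; apply: measurable_coord.
  by apply/seteqP; split => x /= h i; have := h i => //; exact.
rewrite big_ord_recl -IH// -product_measure1E//; last exact: mA.
rewrite /lebesgue_Rd/= /leb_step /pushforward; congr (_ _).
apply/seteqP; split => [[x v]/= vA|[x v]/= [xA vA] i].
  split; first by have := vA ord0; rewrite mxE unlift_none.
  by move=> i; have := vA (lift ord0 i); rewrite mxE liftK.
by rewrite mxE; case: unliftP => [j ->|->].
Qed.

Section prob.
Context {R : realType} {d : nat}.

Definition Prob := probability (Rd R d) R.

(* Weak topology: the coarsest one for which m |-> \int f dm is continuous for
   every bounded continuous f. *)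
Definition bcont := {f : 'rV[R]_d -> R |
  continuous f /\ exists M, forall x, `|f x| <= M}.

Definition pairing (m : Prob) : {ptws bcont -> R} :=
  fun f => \int[m]_x (sval f x).

Definition weak_Prob := initial_topology pairing.

HB.instance Definition _ := Topological.on weak_Prob.

(* mix l m m' is m + l (m' - m).  The weight l is truncated to [0, 1] so that
   the result is a probability measure for every real l; see mixE. *)
Section mix.
Variables (l : R) (m m' : Prob).

Let c : R := Num.max 0 (Num.min l 1).

Let c_ge0 : 0 <= c. Proof. by rewrite le_max lexx. Qed.

Let c_le1 : 0 <= 1 - c.
Proof. by rewrite subr_ge0 ge_max ler01 ge_min lexx orbT. Qed.

Definition mix : set (Rd R d) -> \bar R :=
  measure_add (mscale (NngNum c_le1) m) (mscale (NngNum c_ge0) m').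

HB.instance Definition _ := Measure.on mix.

Let mixE_clamped A : mix A = ((1 - c)%:E * m A + c%:E * m' A)%E.
Proof. exact: measure_addE. Qed.

Let mix_setT : mix setT = 1%E.
Proof.
by rewrite mixE_clamped (probability_setT m) (probability_setT m') !mule1
  -EFinD subrK.
Qed.

HB.instance Definition _ := Measure_isProbability.Build _ _ _ mix mix_setT.

Lemma mixE A : l \in `[0, 1] -> mix A = ((1 - l)%:E * m A + l%:E * m' A)%E.
Proof.
rewrite in_itv/= => /andP[l0 l1].
by rewrite mixE_clamped /c (min_idPl l1) (max_idPr l0).
Qed.

End mix.

(* dG is the flat derivative of G, normalized to have zero mean under m (last
   clause).  Measurability of dG m is implicit in the integrals.  As the left
   side of the fourth clause is finite, that equation includes convergence of
   the integral in l; the inner integral against the signed measure m' - m is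
   written as a difference. *)
Definition flat_derivative (G : Prob -> R) (dG : Prob -> Rd R d -> R) : Prop :=
  [/\ (forall a, continuous (fun m : weak_Prob => dG m a)),
      (forall m, measurable_fun setT (dG m)),
      (forall m, exists M, forall a, `|dG m a| <= M),
      (forall m m' : Prob, (G m' - G m)%:E =
         \int[lebesgue_measure]_(l in `[0%R, 1%R])
           (\int[m']_a (dG (mix l m m') a)%:E -
            \int[m]_a (dG (mix l m m') a)%:E))%E &
      (forall m : Prob, \int[m]_a (dG m a)%:E = 0)%E].

(* d2F m a' a: for fixed a, the flat derivative in the variable a' of
   m |-> dF m a. *)
Definition second_flat_derivative (dF : Prob -> Rd R d -> R)
    (d2F : Prob -> Rd R d -> Rd R d -> R) : Prop :=
  forall a, flat_derivative (fun m => dF m a) (fun m a' => d2F m a' a).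

Definition flat_convex (F : Prob -> R) (dF : Prob -> Rd R d -> R) : Prop :=
  forall m m' : Prob, ((F m - F m')%:E <=
    \int[m]_x (dF m x)%:E - \int[m']_x (dF m x)%:E)%E.

Definition has_density (m : Prob) (f : Rd R d -> R) : Prop :=
  [/\ measurable_fun setT f, (forall x, 0 <= f x) &
      (forall A, measurable A -> m A = \int[lebesgue_Rd]_(x in A) (f x)%:E)%E].

(* A version of the Lebesgue density of m; meaningful when m is absolutely
   continuous, and then a.e. equal to any other density (densityE). *)
Definition density (m : Prob) : Rd R d -> R :=
  fun x => fine (Radon_Nikodym (charge_of_finite_measure m) lebesgue_Rd x).

(* pi is assumed absolutely continuous with respect to Lebesgue measure.
   [ln 0] is 0, so s ln s is 0 at s = 0. *)
Definition KL (m pi : Prob) : \bar R :=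
  if `[< m `<< pi >] then
    (\int[lebesgue_Rd]_x (ln (density m x / density pi x) * density m x)%:E)%E
  else +oo%E.

(* The density proportional to exp (- 2 U / sigma^2).  If the normalizing
   integral is infinite this is 0, hence not the density of a probability. *)
Definition gibbs (sigma : R) (U : Rd R d -> R) : Rd R d -> R :=
  fun x => expR (- (2 / sigma ^+ 2) * U x) /
    \int[lebesgue_Rd]_y expR (- (2 / sigma ^+ 2) * U y).

(* f has derivative l at t as a function on [0, +oo[: two-sided for t > 0
   (is_derive0yE), one-sided at t = 0. *)
Definition is_derive0y (f : R -> R) (t l : R) : Prop :=
  (f s - f t) / (s - t) @[s --> within `[0, +oo[ t^'] --> l.

(* p and r are densities of pi and m. *)
Definition drift (sigma : R) (dF : Prob -> Rd R d -> R) (pi : Prob)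
    (p : Rd R d -> R) (m : Prob) (r : Rd R d -> R) (x : Rd R d) : R :=
  dF m x + sigma ^+ 2 / 2 * ln (r x / p x) - sigma ^+ 2 / 2 * fine (KL m pi).

(* rho t is the density of m t for which the equation holds at every x; only
   the values for t >= 0 are constrained. *)
Definition is_solution (sigma : R) (dF : Prob -> Rd R d -> R) (pi : Prob)
    (p : Rd R d -> R) (m0 : Prob) (rho0 : Rd R d -> R)
    (m : R -> Prob) (rho : R -> Rd R d -> R) : Prop :=
  [/\ m 0 = m0,
      (forall x, rho 0 x = rho0 x),
      (forall t, 0 <= t -> has_density (m t) (rho t)),
      (forall t, 0 <= t -> (KL (m t) pi < +oo)%E) &
      (forall t x, 0 <= t -> is_derive0y (fun s => rho s x) t
         (- drift sigma dF pi p (m t) (rho t) x * rho t x))].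

Definition Vsigma (sigma : R) (F : Prob -> R) (pi m : Prob) : \bar R :=
  ((F m)%:E + (sigma ^+ 2 / 2)%:E * KL m pi)%E.

Lemma densityE (m : Prob) (f : Rd R d -> R) : has_density m f ->
  ae_eq lebesgue_Rd setT (EFin \o density m) (EFin \o f).
Proof.
move=> [mf f0 mE].
have mE' A : measurable A ->
    charge_of_finite_measure m A = (\int[lebesgue_Rd]_(x in A) (f x)%:E)%E.
  exact: mE.
have dom : charge_of_finite_measure m `<< lebesgue_Rd.
  apply/null_content_dominatesP => A mA A0.
  rewrite mE' //; apply: null_set_integral => //.
  exact/measurable_EFinP/measurable_funTS.
have intf : lebesgue_Rd.-integrable setT (EFin \o f).
  apply/integrableP; split; first exact/measurable_EFinP.
  under eq_integral do rewrite /= ger0_norm//.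
  by have <- := mE setT measurableT; rewrite (probability_setT m) ltry.
rewrite (_ : EFin \o density m =
    Radon_Nikodym (charge_of_finite_measure m) lebesgue_Rd); last first.
  by apply/funext => x /=; rewrite /density fineK// Radon_Nikodym_fin_num.
apply: integral_ae_eq => //.
- exact: Radon_Nikodym_integrable.
- exact/measurable_EFinP.
- move=> A _ mA; have <- := mE' A mA.
  by apply/esym; exact: Radon_Nikodym_integral.
Qed.

Lemma is_derive0yE (f : R -> R) (t l : R) : 0 < t ->
  is_derive0y f t l <-> is_derive t 1 f l.
Proof.
move=> t0; have -> : is_derive t 1 f l <->
    (h^-1 *: (f (h *: 1 + t) - f t) @[h --> 0^'] --> l).
  split=> [[df <-]|fl]; first exact: df.
  by split; [apply/cvg_ex; exists l|exact: cvg_lim fl].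
split=> /cvgrPdist_lt fl; apply/cvgrPdist_lt => e e0.
- have /nbhs_ballP[r /= r0 rfl] := fl e e0.
  apply/nbhs_ballP; exists (Num.min r t) => /=; first by rewrite lt_min r0.
  move=> h /=; rewrite /ball/= sub0r normrN lt_min => /andP[hr ht] h0.
  have := rfl (h + t); rewrite /ball/= opprD addrCA subrr addr0 normrN => /(_ hr).
  rewrite -subr_eq0 addrK => /(_ h0); rewrite in_itv/= andbT.
  have -> : 0 <= h + t.
    by rewrite -lerBlDr sub0r; move: ht; rewrite ltr_norml => /andP[/ltW].
  by move=> /(_ isT); rewrite [h *: 1]mulr1 mulrC.
- have /nbhs_ballP[r /= r0 rfl] := fl e e0.
  apply/nbhs_ballP; exists r => //= s; rewrite /ball/= => sr st _.
  have := rfl (s - t); rewrite /ball/= sub0r normrN distrC => /(_ sr).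
  by rewrite subr_eq0 => /(_ st); rewrite [(s - t) *: 1]mulr1 subrK mulrC.
Qed.

End prob.

Arguments Prob : clear implicits.

(* Main.v *)
Require Import Defs.
From mathcomp Require Import all_boot all_order all_algebra.
From mathcomp Require Import all_classical all_reals all_analysis.
From mathcomp Require Import measurable_realfun ring lra.

Set Implicit Arguments.
Unset Strict Implicit.
Unset Printing Implicit Defensive.

Import Order.TTheory GRing.Theory Num.Theory.
Import numFieldNormedType.Exports.

Local Open Scope classical_set_scope.
Local Open Scope ring_scope.

(** Write s = sigma^2/2, p for the density of pi, h t = rho t / p and
k t = KL(m_t|pi).  The formula is the chain rule for V along the flow, and the
work lies in justifying it when nothing is known beforehand about the
regularity of k.

At each point x the equation reads h' = - (a + s ln h - s k) h, where
a = dF(m_t, x) is bounded by C.  The nonlocal term k is the same at all points,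
so it cancels in the ratio of the paths through two points x and y, which
solves q' = - (b + s ln q) q with |b| <= 2C.  Such a ratio stays below the
explicit solution of the extremal linear equation for ln q
([log_ode_upper]), uniformly in x because h 0 <= B.  Hence h is bounded on
[0, b] x R^d by a multiple of the maximum on [0, b] of one continuous path
([flow_bounded]).  The bound on h bounds k, then h', then the derivative of
h ln h: the increments of rho and of the entropy density rho ln(rho / p) are at
most L |r - t| p(x), with p integrable ([solution_lipschitz]).
Differentiation under the integral sign of KL is then dominated convergence.

For F, convexity is applied at both end points:
<<
int dF(m_t) (rho_r - rho_t) <= F(m_r) - F(m_t) <= int dF(m_r) (rho_r - rho_t).
>>
After division by r - t both bounds have the limit int dF(m_t) rho_t', because
m_r tends weakly to m_t and dF(., x) is weakly continuous; this gives the
derivative of F(m_t) without the integral over the segment from m_t to m_r.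

Adding the two derivatives, and subtracting a multiple of int rho_t' = 0 to
centre the entropy term, gives the integral of drift times rho_t', that is
minus the integral of drift^2 rho_t ([energy_is_derive]). *)

(** * Calculus on the half-line *)

Section half_line.
Context {R : realType}.
Implicit Types (f g df : R -> R) (t l c s y : R).

Lemma is_derive1P f t l : is_derive t 1 f l <->
  (h^-1 * (f (h + t) - f t) @[h --> 0^'] --> l).
Proof.
have E : (fun h : R => h^-1 *: (f (h *: (1 : R) + t) - f t)) =
    (fun h => h^-1 * (f (h + t) - f t)).
  by apply/funext => h; rewrite [h *: (1 : R)]mulr1.
split=> [[df <-]|fl].
  by rewrite -E; exact: df.
rewrite -E in fl.
by split; [apply/cvg_ex; exists l|exact: cvg_lim fl].
Qed.

(** Prolonging f below 0 by its tangent line turns the one-sided derivative at 0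
into a two-sided one, so the rules of differentiation need no proof of their
own on the half-line. *)
Lemma is_derive0y_ext f t l : 0 <= t -> is_derive0y f t l <->
  exists2 g, (forall s, 0 <= s -> g s = f s) & is_derive t 1 g l.
Proof.
move=> t0; split=> [fl|[g gf /is_derive1P gl]].
  exists (fun s => if 0 <= s then f s else f t + l * (s - t)).
    by move=> s ->.
  apply/is_derive1P/cvgrPdist_lt => e e0.
  move/cvgrPdist_lt : fl => /(_ e e0)/nbhs_ballP[r /= r0 rfl].
  apply/nbhs_ballP; exists r => //= h; rewrite /ball/= sub0r normrN => hr h0.
  rewrite t0; case: ifPn => [ht|_]; last first.
    by rewrite addrK addrAC subrr add0r mulrCA mulVf// mulr1 subrr normr0.
  have := rfl (h + t); rewrite /ball/= opprD addrCA subrr addr0 normrN => /(_ hr).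
  rewrite -subr_eq0 addrK => /(_ h0); rewrite in_itv/= andbT => /(_ ht).
  by rewrite mulrC.
apply/cvgrPdist_lt => e e0.
move/cvgrPdist_lt : gl => /(_ e e0)/nbhs_ballP[r /= r0 rgl].
apply/nbhs_ballP; exists r => //= s; rewrite /ball/= => sr st.
rewrite in_itv/= andbT => s0.
have := rgl (s - t); rewrite /ball/= sub0r normrN distrC => /(_ sr).
by rewrite subr_eq0 => /(_ st); rewrite subrK !gf// mulrC.
Qed.

Lemma is_derive0y_comp f t l g dg : 0 <= t -> is_derive0y f t l ->
  is_derive (f t) 1 g dg -> is_derive0y (g \o f) t (dg * l).
Proof.
move=> t0 /(is_derive0y_ext _ _ t0)[F Ff Fl] gdg.
apply/is_derive0y_ext => //; exists (g \o F) => [s s0 /=|]; first by rewrite Ff.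
rewrite -(Ff _ t0) in gdg.
by apply: is_derive_eq; rewrite mulrC.
Qed.

Lemma is_derive0yM f g t l l' : 0 <= t -> is_derive0y f t l ->
  is_derive0y g t l' -> is_derive0y (f \* g) t (f t * l' + g t * l).
Proof.
move=> t0 /(is_derive0y_ext _ _ t0)[F Ff Fl] /(is_derive0y_ext _ _ t0)[G Gg Gl].
apply/is_derive0y_ext => //; exists (F * G) => [s s0 /=|].
  by rewrite -Ff// -Gg.
by rewrite -(Ff _ t0) -(Gg _ t0); exact: is_deriveM.
Qed.

Lemma is_derive0yZ f t l c : 0 <= t -> is_derive0y f t l ->
  is_derive0y (fun r => c * f r) t (c * l).
Proof.
move=> t0 fl; apply: (is_derive0y_comp (g := fun y => c * y)) => //.
have H := is_deriveZ c (is_derive_id (f t) (1 : R)).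
by apply: (is_derive_eq (f := c \*: id) H); rewrite [_ *: _]mulr1.
Qed.

Lemma is_derive0y_within f df a b : 0 <= a ->
  (forall t, 0 <= t -> is_derive0y f t (df t)) ->
  {within `[a, b], continuous f}.
Proof.
move=> a0 fdf; apply/subspace_continuousP => t.
rewrite [X in X -> _]/= in_itv/= => /andP[at_ tb].
have t0 : 0 <= t := le_trans a0 at_.
have /(is_derive0y_ext _ _ t0)[g gf gl] := fdf t t0.
have gc : g s @[s --> t] --> g t.
  by apply: differentiable_continuous; apply/derivable1_diffP; case: gl.
move: gc; rewrite gf// => gc.
apply: cvg_trans (cvg_within_filter _ gc).
apply: near_eq_cvg; near=> s; apply: gf.
have : `[a, b]%classic s by near: s; exact: withinT.
by rewrite /= in_itv/= => /andP[/(le_trans a0)].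
Unshelve. all: by end_near. Qed.

Lemma mean_value0y f df a b : 0 <= a -> a <= b ->
  (forall t, 0 <= t -> is_derive0y f t (df t)) ->
  exists2 t, a <= t <= b & f b - f a = df t * (b - a).
Proof.
move=> a0 ab fdf.
have [x xab|c cab ->] := @MVT_segment _ f df a b ab _ (is_derive0y_within a0 fdf).
  move: xab; rewrite in_itv/= => /andP[ax _].
  have x0 := le_lt_trans a0 ax.
  by apply/is_derive0yE => //; apply: fdf; exact: ltW.
by exists c.
Qed.

Lemma lipschitz0y f df T L : (forall t, 0 <= t -> is_derive0y f t (df t)) ->
  (forall t, 0 <= t <= T -> `|df t| <= L) ->
  forall r t, 0 <= r <= T -> 0 <= t <= T -> `|f r - f t| <= L * `|r - t|.
Proof.
move=> fdf dfL r t; wlog tr : r t / t <= r.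
  move=> H rT tT; have [/H|/ltW/H] := leP t r; first exact.
  by rewrite distrC (distrC r); exact.
move=> /andP[r0 rT] /andP[t0 tT].
have [c /andP[tc cr] ->] := mean_value0y t0 tr fdf.
rewrite normrM ler_wpM2r// dfL// (le_trans t0 tc)/=.
exact: le_trans rT.
Qed.

Lemma is_derive_quadratic g y l :
  (forall h, `|g (h + y) - g y - l * h| <= h ^+ 2) -> is_derive y 1 g l.
Proof.
move=> gl; apply/is_derive1P/cvgrPdist_le => e e0.
apply/nbhs_ballP; exists e => //= h; rewrite /ball/= sub0r normrN => he h0.
have h_gt0 : 0 < `|h| by rewrite normr_gt0.
rewrite -(ler_pM2l h_gt0) -normrM mulrBr mulVKf// distrC (mulrC h).
apply: le_trans (gl h) _.
by rewrite -[h ^+ 2]ger0_norm ?sqr_ge0// expr2 normrM ler_wpM2l// ltW.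
Qed.

(** The squared positive part detects whether a function exceeds c and, unlike
the positive part, is differentiable everywhere. *)
Lemma is_derive_sqr_max c y :
  is_derive y 1 (fun z : R => Num.max (z - c) 0 ^+ 2) (2 * Num.max (y - c) 0).
Proof.
apply: is_derive_quadratic => h.
rewrite ler_norml; case: (leP (h + y - c) 0) => ?; case: (leP (y - c) 0) => ?;
  apply/andP; split; nra.
Qed.

(** The square of max (f - c) 0 has derivative 2 max (f - c) 0 * f' <= 0 and
starts at 0, so it vanishes. *)
Lemma barrier0y f df c : (forall t, 0 <= t -> is_derive0y f t (df t)) ->
  f 0 <= c -> (forall t, 0 <= t -> c < f t -> df t <= 0) ->
  forall t, 0 <= t -> f t <= c.
Proof.
move=> fdf f0 df0 t t0.
pose w z : R := Num.max (z - c) 0 ^+ 2.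
have [r r0 wE] := @mean_value0y (w \o f)
  (fun r => 2 * Num.max (f r - c) 0 * df r) 0 t (lexx _) t0
  (fun r r0 => is_derive0y_comp r0 (fdf r r0) (is_derive_sqr_max c (f r))).
have w0 : (w \o f) 0 = 0.
  by rewrite /w/= max_r ?subr_le0// expr0n.
rewrite w0 !subr0 in wE; move: r0 => /andP[r0 _].
have : (w \o f) t <= 0.
  rewrite wE mulr_le0_ge0//.
  have [fr|fr] := leP (f r) c; first by rewrite max_r ?subr_le0// mulr0 mul0r.
  by rewrite mulr_ge0_le0 ?df0// mulr_ge0// le_max lexx orbT.
rewrite /w/=; case: (leP (f t - c) 0); first by rewrite subr_le0.
by move=> f_gt0; rewrite leNgt exprn_gt0.
Qed.

Lemma barrier0y_ge f df c : (forall t, 0 <= t -> is_derive0y f t (df t)) ->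
  c <= f 0 -> (forall t, 0 <= t -> f t < c -> 0 <= df t) ->
  forall t, 0 <= t -> c <= f t.
Proof.
move=> fdf f0 df0 t t0; rewrite -lerN2.
apply: (@barrier0y (-%R \o f) (fun r => - 1 * df r)) => //=.
- move=> r r0; apply: is_derive0y_comp => //; exact: fdf.
- by rewrite lerN2.
- by move=> r r0; rewrite ltrN2 mulN1r oppr_le0; exact: df0.
Qed.

Lemma is_derive0y_cvgn f t l (u : R^nat) : is_derive0y f t l ->
  (forall n, 0 <= u n) -> (forall n, u n != t) -> u @ \oo --> t ->
  (f (u n) - f t) / (u n - t) @[n --> \oo] --> l.
Proof.
move=> /cvgrPdist_lt fl u0 ut u_t; apply/cvgrPdist_lt => e e0.
have /nbhs_ballP[r /= r0 rfl] := fl e e0.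
move/cvgrPdist_lt : u_t => /(_ r r0); apply: filterS => n unt.
by apply: rfl; rewrite //= in_itv/= andbT.
Qed.

(** Dominated convergence speaks of sequences.  Those staying in a bounded
interval suffice, which is where the flow is controlled. *)
Lemma cvgn_is_derive0y f t l : 0 <= t ->
  (forall u : R^nat, (forall n, 0 <= u n <= t + 1) -> (forall n, u n != t) ->
    u @ \oo --> t -> (f (u n) - f t) / (u n - t) @[n --> \oo] --> l) ->
  is_derive0y f t l.
Proof.
move=> t0 H; apply: contrapT => /cvgrPdist_lt.
move=> /existsNP[e /not_implyP[e0 nfl]].
have P n : exists s, [/\ 0 <= s, s != t, `|t - s| < n.+1%:R^-1 &
    e <= `|l - (f s - f t) / (s - t)|].
  apply: contrapT => /forallNP nP; apply: nfl; apply/nbhs_ballP.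
  exists n.+1%:R^-1 => /=; first by rewrite invr_gt0.
  move=> s ts st; rewrite in_itv/= andbT => s0.
  by rewrite ltNge; apply/negP => es; exact: (nP s).
pose u n := sval (cid (P n)).
have uP n : [/\ 0 <= u n, u n != t, `|t - u n| < n.+1%:R^-1 &
    e <= `|l - (f (u n) - f t) / (u n - t)|] := svalP (cid (P n)).
have /cvgrPdist_lt/(_ e e0)[N _ /(_ N (leqnn N))] :
    (f (u n) - f t) / (u n - t) @[n --> \oo] --> l.
  apply: H => [n|n|].
  - have [un0 _ unt _] := uP n; rewrite un0/=.
    have n1 : n.+1%:R^-1 <= 1 :> R by rewrite invf_le1// ler1n.
    by move: (lt_le_trans unt n1); rewrite ltr_distlC => /andP[? ?]; lra.
  - by have [] := uP n.
  - apply/cvgrPdist_lt => r r0; near=> n; have [_ _ unt _] := uP n.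
    apply: lt_trans unt _; near: n.
    exact: (near_infty_natSinv_lt (PosNum r0)).
by rewrite ltNge; have [_ _ _ ->] := uP N.
Unshelve. all: by end_near. Qed.

End half_line.

(** * Paths of the logarithmic equation *)

Section log_ode.
Context {R : realType}.
Implicit Types (s t y : R).

Lemma ln_le_subr1 y : 0 < y -> ln y <= y - 1.
Proof.
move=> y0; have := @le_ln1Dx R (y - 1).
by rewrite [1 + _]addrC subrK; apply; rewrite ltrBrDr addNr.
Qed.

Lemma mulr_ln_ge y : 0 <= y -> y - 1 <= y * ln y.
Proof.
rewrite le_eqVlt => /orP[/eqP <-|y0]; first by rewrite mul0r sub0r lerN10.
have yV : 0 < y^-1 by rewrite invr_gt0.
have := ln_le_subr1 yV; rewrite lnV ?posrE// -(ler_pM2l y0) mulrBr mulfV ?gt_eqF//.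
by rewrite mulrN mulr1; lra.
Qed.

Lemma normr_mulr_ln y : 0 <= y -> `|y * ln y| <= 1 + y ^+ 2.
Proof.
move=> y0; rewrite ler_norml; apply/andP; split.
  by have := mulr_ln_ge y0; nra.
move: y0; rewrite le_eqVlt => /orP[/eqP <-|y0].
  by rewrite mul0r expr0n addr0.
by have := ln_le_subr1 y0; nra.
Qed.

(** With w = sqrt y, the left side is 4 (w ln w)^2. *)
Lemma mulr_sqr_ln y : 0 <= y -> y * ln y ^+ 2 <= 4 * (1 + y) ^+ 2.
Proof.
move=> y0; set w := Num.sqrt y.
have yw : y = w ^+ 2 by rewrite sqr_sqrtr.
have w0 : 0 <= w by exact: sqrtr_ge0.
have lnyw : ln y = 2 * ln w.
  rewrite yw; move: w0; rewrite le_eqVlt => /orP[/eqP <-|w0].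
    by rewrite expr0n ln0// mulr0.
  by rewrite lnXn// mulr_natl.
have wlnw : `|w * ln w| ^+ 2 <= (1 + y) ^+ 2.
  by rewrite yw ler_sqr ?nnegrE ?addr_ge0 ?sqr_ge0 ?normr_mulr_ln.
rewrite lnyw [X in X * _]yw.
suff -> : w ^+ 2 * (2 * ln w) ^+ 2 = 4 * `|w * ln w| ^+ 2 by rewrite ler_pM2l.
by rewrite real_normK ?num_real//; ring.
Qed.

(** The equation followed by h = rho / p at one point, with k the nonlocal
term.  As ln 0 = 0, the zero path is a solution. *)
Definition log_ode (s : R) (k a h : R -> R) := forall t, 0 <= t ->
  is_derive0y h t (- (a t + s * ln (h t) - s * k t) * h t).

(** Below exp (- C / s) the bracket a + s ln h - s k is nonpositive, because
k >= 0 only helps; hence h cannot decrease there, and a lower bound on k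
suffices to keep h away from 0. *)
Lemma log_ode_lower s (C : R) k a h : 0 < s ->
  (forall t, 0 <= t -> 0 <= h t) -> (forall t, 0 <= t -> 0 <= k t) ->
  (forall t, 0 <= t -> a t <= C) ->
  log_ode s k a h -> 0 < h 0 ->
  exists2 c, 0 < c & forall t, 0 <= t -> c <= h t.
Proof.
move=> s0 h_ge0 k_ge0 aC hode h0.
exists (Num.min (h 0) (expR (- (C / s)))).
  by rewrite lt_min h0 expR_gt0.
set c := Num.min _ _.
apply: barrier0y_ge; [exact: hode|by rewrite /c ge_min lexx|].
move=> t t0 htc; have := h_ge0 t t0; rewrite le_eqVlt => /orP[/eqP <-|ht].
  by rewrite mulr0.
rewrite mulNr oppr_ge0 mulr_le0_ge0 ?ltW//.
have : ln (h t) < - (C / s).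
  rewrite -ltr_expR lnK ?posrE//; apply: lt_le_trans htc _.
  by rewrite /c ge_min lexx orbT.
rewrite -mulNr ltr_pdivlMr// mulrC => lnh.
by have := aC t t0; have := mulr_ge0 (ltW s0) (k_ge0 t t0); lra.
Qed.

(** The unknown k cancels in the ratio. *)
Lemma log_ode_ratio s k a1 a2 h1 h2 :
  (forall t, 0 <= t -> 0 <= h1 t) -> (forall t, 0 <= t -> 0 < h2 t) ->
  log_ode s k a1 h1 -> log_ode s k a2 h2 ->
  log_ode s (fun=> 0) (fun t => a1 t - a2 t) (fun t => h1 t / h2 t).
Proof.
move=> h1_ge0 h2_gt0 ode1 ode2 t t0.
have h2t := h2_gt0 t t0; have h2n0 : h2 t != 0 by rewrite gt_eqF.
have := is_derive0yM t0 (ode1 t t0) (is_derive0y_comp t0 (ode2 t t0)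
  (is_deriveV h2n0 (is_derive_id (h2 t) (1 : R)))).
congr is_derive0y; rewrite /=.
have := h1_ge0 t t0; rewrite le_eqVlt => /orP[/eqP <-|h1t].
  by ring.
by rewrite ln_div ?posrE// [_ *: _]mulr1; field.
Qed.

(** The exponent G on the right solves G' = C - s G, G 0 = g0, which is the
equation of ln q with the coefficient a replaced by its lower bound - C.  The
barrier lemma applies to q exp (- G) at level 1, and so needs ln q only where
q > 0. *)
Lemma log_ode_upper s (C g0 : R) a q : 0 < s ->
  (forall t, 0 <= t -> 0 <= q t) -> (forall t, 0 <= t -> - C <= a t) ->
  log_ode s (fun=> 0) a q -> q 0 <= expR g0 ->
  forall t, 0 <= t ->
  q t <= expR (C / s + (g0 - C / s) * expR (- s * t)).
Proof.
move=> s0 q_ge0 aC qode q0 t t0.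
pose G (r : R) := C / s + (g0 - C / s) * expR (- s * r).
have dEG (r : R) :
    is_derive r 1 (fun r : R => expR (- G r)) ((s * G r - C) * expR (- G r)).
  have : is_derive r 1 (expR \o
      - (cst (C / s) + (g0 - C / s) \*: (expR \o (- s \*: @idfun R))))
    ((s * G r - C) * expR (- G r)).
    apply: is_derive_eq.
    rewrite /GRing.scale/= !(mulr1, add0r).
    rewrite -/(expR (- G r)) mulrC; congr (_ * expR (- G r)).
    by rewrite /G [_ *: _]/(_ * _); field; rewrite gt_eqF.
  exact.
suff : q t * expR (- G t) <= 1.
  by rewrite expRN ler_pdivrMr ?expR_gt0// mul1r.
apply: (@barrier0y _ (fun r => q r * expR (- G r)) _ 1 _ _ _ t t0).
- move=> r r0; apply: is_derive0yM => //; first exact: qode.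
  apply/is_derive0y_ext => //; exists (fun r => expR (- G r)) => //; exact: dEG.
- rewrite expRN ler_pdivrMr ?expR_gt0// mul1r /G mulr0 expR0 mulr1.
  by rewrite addrC subrK.
- move=> r r0; rewrite expRN ltr_pdivlMr ?expR_gt0// mul1r => Gq.
  have qr : 0 < q r by apply: lt_trans Gq; exact: expR_gt0.
  have {}Gq : G r < ln (q r) by rewrite -ltr_expR lnK.
  rewrite (_ : _ + _ =
      - (a r + C + s * (ln (q r) - G r)) * (q r * expR (- G r))); last by ring.
  rewrite mulNr oppr_le0 !mulr_ge0 ?expR_ge0 ?(ltW qr)//.
  rewrite addr_ge0 ?mulr_ge0 ?(ltW s0) ?subr_ge0 ?(ltW Gq)//.
  by rewrite addrC -lerBlDl sub0r; exact: aC.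
Qed.

(** The nonlinearity q ln q is not Lipschitz at 0; uniqueness of the zero path
comes from the previous bound, which tends to 0 as g0 tends to - oo. *)
Lemma log_ode_zero s (C : R) a q : 0 < s ->
  (forall t, 0 <= t -> 0 <= q t) -> (forall t, 0 <= t -> - C <= a t) ->
  log_ode s (fun=> 0) a q -> q 0 = 0 -> forall t, 0 <= t -> q t = 0.
Proof.
move=> s0 q_ge0 aC qode q0 t t0.
apply/eqP; rewrite eq_le q_ge0// andbT leNgt; apply/negP => qt.
set e := expR (- s * t); have e0 : 0 < e := expR_gt0 _.
(* This choice makes the upper bound equal to q t / exp 1. *)
pose g0 := C / s + (ln (q t) - C / s - 1) / e.
have := @log_ode_upper s C g0 a q s0 q_ge0 aC qode _ t t0.
rewrite q0 expR_ge0 => /(_ isT); rewrite -/e.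
have -> : C / s + (g0 - C / s) * e = ln (q t) - 1.
  by rewrite /g0; field; rewrite !gt_eqF.
by rewrite -[X in X <= _](lnK qt) ler_expR; lra.
Qed.

Lemma is_derive0y_mulr_ln h t l : 0 <= t -> 0 < h t -> is_derive0y h t l ->
  is_derive0y (fun r => h r * ln (h r)) t ((ln (h t) + 1) * l).
Proof.
move=> t0 ht hl; apply: (is_derive0y_comp (g := fun y => y * ln y)) => //.
have H := is_deriveM (is_derive_id (h t) (1 : R)) (is_derive1_ln ht).
apply: (@is_derive_eq _ _ _ _ _ _ _ _ H).
by rewrite /GRing.scale/= mulfV ?gt_eqF// mulr1 addrC.
Qed.

End log_ode.

(** * Families of paths driven by a common nonlocal term *)

Section log_flow.
Context {R : realType} {T : Type}.
Implicit Types (t b : R) (x : T).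

Record log_flow (s C B : R) (k : R -> R) (a h : R -> T -> R) : Prop := LogFlow {
  flow_s_gt0 : 0 < s;
  flow_ge0 : forall t x, 0 <= t -> 0 <= h t x;
  flow_k_ge0 : forall t, 0 <= t -> 0 <= k t;
  flow_a_le : forall t x, 0 <= t -> `|a t x| <= C;
  flow_ode : forall x, log_ode s k (a^~ x) (h^~ x);
  flow_init_le : forall x, h 0 x <= B;
  flow_init_gt0 : exists x, 0 < h 0 x }.

Arguments flow_ode {s C B k a h} _ x.

Variables (s C B : R) (k : R -> R) (a h : R -> T -> R).
Hypothesis hF : log_flow s C B k a h.

Let s0 := flow_s_gt0 hF.
Let dh t x := - (a t x + s * ln (h t x) - s * k t) * h t x.

Lemma flow_C_ge0 : 0 <= C.
Proof.
have [x _] := flow_init_gt0 hF.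
by apply: le_trans (flow_a_le hF x (lexx 0)); exact: normr_ge0.
Qed.

Lemma flow_gt0 x : 0 < h 0 x -> forall t, 0 <= t -> 0 < h t x.
Proof.
move=> hx t t0.
have [|||c c0 hc] := log_ode_lower (C := C) s0 _ _ _ (flow_ode hF x) hx.
- by move=> r; exact: flow_ge0 hF _ _.
- exact: flow_k_ge0 hF.
- by move=> r r0; apply: le_trans (flow_a_le hF x r0); exact: ler_norm.
- exact: lt_le_trans c0 (hc t t0).
Qed.

Lemma flow_ratio x y : 0 < h 0 y ->
  [/\ forall t, 0 <= t -> 0 <= h t x / h t y,
      forall t, 0 <= t -> - (2 * C) <= a t x - a t y &
      log_ode s (fun=> 0) (fun t => a t x - a t y) (fun t => h t x / h t y)].
Proof.
move=> hy; split.
- by move=> t t0; rewrite divr_ge0 ?(flow_ge0 hF).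
- move=> t t0; have := flow_a_le hF x t0; have := flow_a_le hF y t0.
  by rewrite !ler_norml => /andP[? ?] /andP[? ?]; lra.
- apply: log_ode_ratio (flow_ode hF x) (flow_ode hF y).
    by move=> r; exact: flow_ge0 hF _ _.
  exact: flow_gt0.
Qed.

(** Compared with a positive path, a path starting at 0 gives a ratio that
starts at 0. *)
Lemma flow_zero x : h 0 x = 0 -> forall t, 0 <= t -> h t x = 0.
Proof.
move=> hx t t0; have [y hy] := flow_init_gt0 hF.
have [q_ge0 aC qode] := flow_ratio x hy.
have := log_ode_zero s0 q_ge0 aC qode _ t0; rewrite hx mul0r => /(_ erefl)/eqP.
by rewrite mulf_eq0 invr_eq0 (gt_eqF (flow_gt0 hy t0)) orbF => /eqP.
Qed.

(** All paths are compared with a single positive one, whose maximum on [0, b]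
is finite by continuity; no bound on k is available at this point. *)
Lemma flow_bounded b : exists2 M, 0 <= M &
  forall t x, 0 <= t <= b -> h t x <= M.
Proof.
have [b0|b0] := leP 0 b; last first.
  by exists 0 => // t x /andP[t0 /(le_trans t0)]; rewrite leNgt b0.
have [y hy] := flow_init_gt0 hF.
have [c cb hc] := EVT_max b0 (is_derive0y_within (b := b) (lexx 0) (flow_ode hF y)).
pose g0 := Num.max 0 (ln (B / h 0 y)).
have g0_ge0 : 0 <= g0 by rewrite le_max lexx.
have D_ge0 : 0 <= 2 * C / s by rewrite divr_ge0 ?mulr_ge0 ?flow_C_ge0 ?(ltW s0).
have hc_ge0 : 0 <= h c y.
  by apply: (flow_ge0 hF); move: cb; rewrite in_itv/= => /andP[].
exists (expR (2 * C / s + g0) * h c y); first by rewrite mulr_ge0 ?expR_ge0.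
move=> t x /andP[t0 tb].
have [q_ge0 aC qode] := flow_ratio x hy.
have hty := flow_gt0 hy t0.
have -> : h t x = h t x / h t y * h t y by rewrite divfK ?gt_eqF.
apply: ler_pM => //; [exact: q_ge0|exact: ltW| |]; last first.
  by apply: hc; rewrite in_itv/= t0.
apply: le_trans (log_ode_upper s0 q_ge0 aC qode (g0 := g0) _ t0) _.
  have B0 : 0 < B by apply: lt_le_trans hy (flow_init_le hF y).
  apply: (@le_trans _ _ (B / h 0 y)).
    by rewrite ler_pM2r ?invr_gt0// (flow_init_le hF).
  rewrite -[X in X <= _]lnK ?posrE ?divr_gt0// ler_expR /g0 le_max lexx orbT //.
rewrite ler_expR lerD2l.
have E1 : expR (- s * t) <= 1.
  by rewrite expR_le1 mulNr oppr_le0 mulr_ge0 // ltW.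
have E0 := expR_ge0 (- s * t).
by nra.
Qed.

Lemma flow_is_derive_entropy x t : 0 <= t ->
  is_derive0y (fun r => h r x * ln (h r x)) t ((ln (h t x) + 1) * dh t x).
Proof.
move=> t0; have := flow_ge0 hF x (lexx 0).
rewrite le_eqVlt => /orP[/eqP/esym hx|hx]; last first.
  by apply: is_derive0y_mulr_ln; [|exact: flow_gt0|exact: (flow_ode hF x)].
rewrite /dh (flow_zero hx t0) !mulr0.
apply/is_derive0y_ext => //; exists (cst 0) => [r r0|]; last exact: is_derive_cst.
by rewrite flow_zero// mul0r.
Qed.

(** The derivative of h ln h contains the term s h (ln h)^2, which is bounded
for bounded h although ln h is not. *)
Lemma flow_lipschitz b K : (forall t, 0 <= t <= b -> k t <= K) ->
  exists2 L, 0 <= L & forall x r t, 0 <= r <= b -> 0 <= t <= b ->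
    `|h r x - h t x| <= L * `|r - t| /\
    `|h r x * ln (h r x) - h t x * ln (h t x)| <= L * `|r - t|.
Proof.
move=> kK; have [M M0 hM] := flow_bounded b.
have C0 := flow_C_ge0.
pose D := C + s * `|K|.
have D0 : 0 <= D by rewrite addr_ge0 // mulr_ge0 // ltW.
pose L1 := D * M + s * (1 + M ^+ 2).
pose L2 := D * (1 + M ^+ 2) + s * (4 * (1 + M) ^+ 2).
have L1_ge0 : 0 <= L1.
  by rewrite addr_ge0// mulr_ge0 ?(ltW s0)// addr_ge0// sqr_ge0.
have L2_ge0 : 0 <= L2.
  have ? : 0 <= 1 + M ^+ 2 by rewrite addr_ge0// sqr_ge0.
  have ? : 0 <= 4 * (1 + M) ^+ 2 by rewrite mulr_ge0// sqr_ge0.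
  by rewrite addr_ge0// mulr_ge0// ltW.
have aD t x : 0 <= t <= b -> `|a t x - s * k t| <= D.
  move=> /andP[t0 tb]; apply: le_trans (ler_normB _ _) _.
  rewrite lerD ?(flow_a_le hF)// normrM (gtr0_norm s0) ler_pM2l//.
  rewrite ger0_norm ?(flow_k_ge0 hF)//.
  by apply: le_trans (ler_norm K); rewrite kK// t0.
have lnM t x : 0 <= t <= b -> `|h t x * ln (h t x)| <= 1 + M ^+ 2.
  move=> tb; have /andP[t0 _] := tb; have ht := flow_ge0 hF x t0.
  apply: le_trans (normr_mulr_ln ht) _.
  by rewrite lerD2l ler_sqr ?nnegrE// hM.
have dhE t x : dh t x =
  - ((a t x - s * k t) * h t x + s * (h t x * ln (h t x))) by rewrite /dh; ring.
have dh1 t x : 0 <= t <= b -> `|dh t x| <= L1.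
  move=> tb; have /andP[t0 _] := tb.
  rewrite dhE normrN; apply: le_trans (ler_normD _ _) _.
  rewrite lerD// normrM.
    by rewrite ler_pM// ?aD// ger0_norm ?(flow_ge0 hF)// hM.
  by rewrite (gtr0_norm s0) ler_pM2l// lnM.
have dh2 t x : 0 <= t <= b -> `|(ln (h t x) + 1) * dh t x| <= L1 + L2.
  move=> tb; have /andP[t0 _] := tb; have ht := flow_ge0 hF x t0.
  rewrite mulrDl mul1r addrC; apply: le_trans (ler_normD _ _) _.
  rewrite lerD ?dh1//.
  have -> : ln (h t x) * dh t x = - ((a t x - s * k t) * (h t x * ln (h t x)) +
      s * (h t x * ln (h t x) ^+ 2)) by rewrite dhE; ring.
  rewrite normrN; apply: le_trans (ler_normD _ _) _.
  rewrite lerD// normrM; first by rewrite ler_pM// ?aD// lnM.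
  rewrite (gtr0_norm s0) ler_pM2l// ger0_norm; last exact: mulr_ge0 ht (sqr_ge0 _).
  apply: le_trans (mulr_sqr_ln ht) _.
  by rewrite ler_pM2l// ler_sqr ?nnegrE ?addr_ge0// lerD2l hM.
exists (L1 + L2); first exact: addr_ge0.
move=> x r t rb tb.
split.
  apply: le_trans (lipschitz0y (flow_ode hF x) (dh1^~ x) rb tb) _.
  by rewrite ler_wpM2r// lerDl.
apply: (@lipschitz0y _ (fun r => h r x * ln (h r x))
  (fun r => (ln (h r x) + 1) * dh r x) b) rb tb => r'.
  exact: flow_is_derive_entropy.
exact: dh2.
Qed.

End log_flow.

(** * Densities and relative entropy *)

Section integrals.
Context {R : realType} d (T : measurableType d) (mu : {measure set T -> \bar R}).
Implicit Types (f g p : T -> R).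

(** Integrability is required of the lower function only; g may have the
integral +oo. *)
Lemma le_integral_integrable f g : mu.-integrable setT (EFin \o f) ->
  measurable_fun setT g -> (forall x, f x <= g x) ->
  (\int[mu]_x (f x)%:E <= \int[mu]_x (g x)%:E)%E.
Proof.
move=> intf mg fg; have mf := measurable_int _ intf.
have mg' : measurable_fun setT (fun x => (g x)%:E) by exact/measurable_EFinP.
rewrite integralE [leRHS]integralE leeB//; apply: ge0_le_integral => //.
- exact: measurable_funepos.
- exact: measurable_funepos.
- by move=> x _; apply: (funepos_le (D := setT)) => [y _|]; rewrite ?inE ?lee_fin.
- exact: measurable_funeneg.
- exact: measurable_funeneg.
- by move=> x _; apply: (funeneg_le (D := setT)) => [y _|]; rewrite ?inE ?lee_fin.
Qed.

Lemma dominated_integrable f p : mu.-integrable setT (EFin \o p) ->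
  measurable_fun setT f -> (exists c, forall x, `|f x| <= c * p x) ->
  mu.-integrable setT (EFin \o f).
Proof.
move=> intp mf [c fc].
apply: (le_integrable measurableT (g := EFin \o (fun x => c * p x))) => //.
- exact/measurable_EFinP.
- by move=> x _; rewrite /= lee_fin (le_trans (fc x))// ler_norm.
- exact: (integrableZl measurableT c intp).
Qed.

Lemma dominated_cvg_Rintegral (f_ : (T -> R)^nat) f p c :
  mu.-integrable setT (EFin \o p) ->
  (forall n, measurable_fun setT (f_ n)) -> (forall n x, `|f_ n x| <= c * p x) ->
  (forall x, f_ ^~ x @ \oo --> f x) ->
  mu.-integrable setT (EFin \o f) /\
  (\int[mu]_x f_ n x @[n --> \oo] --> \int[mu]_x f x).
Proof.
move=> intp mf_ f_c f_f.
have mf : measurable_fun setT f.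
  by apply: measurable_fun_cvg => // x _; exact: f_f.
have [|||||intf _ cvgf] := @dominated_convergence _ _ _ mu setT measurableT
  (fun n => EFin \o f_ n) (EFin \o f) (EFin \o (fun x => c * p x)).
- by move=> n; exact/measurable_EFinP.
- exact/measurable_EFinP.
- by apply: aeW => x _; apply: cvg_EFin; [near=> n; rewrite fin_numE|exact: f_f].
- exact: (integrableZl measurableT c intp).
- by apply: aeW => x n _; rewrite /= lee_fin.
split => //; apply: fine_cvg; rewrite fineK//.
exact: integrable_fin_num.
Unshelve. all: by end_near. Qed.

End integrals.

Section density.
Context {R : realType} {d : nat}.
Implicit Types (m pi : Prob R d) (f g p : Rd R d -> R).
Local Notation leb := (@lebesgue_Rd R d).

Lemma measurable_density m : measurable_fun setT (density m).
Proof.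
apply: measurableT_comp => //.
have [dom|ndom] := pselect (charge_of_finite_measure m `<< leb).
  exact: measurable_int (Radon_Nikodym_integrable dom).
rewrite /Radon_Nikodym; case: pselect => //= _; exact: measurable_cst.
Qed.

Lemma has_density_integral m f : has_density m f ->
  (\int[leb]_x (f x)%:E)%E = 1%E.
Proof. by move=> [_ _ mE]; rewrite -mE// (probability_setT m). Qed.

Lemma has_density_integrable m f : has_density m f ->
  leb.-integrable setT (EFin \o f).
Proof.
move=> mf; have [f_meas f0 _] := mf; apply/integrableP; split.
  exact/measurable_EFinP.
under eq_integral do rewrite /= ger0_norm//.
by rewrite (has_density_integral mf) ltry.
Qed.

Lemma has_density_ae m f : has_density m f ->
  ae_eq leb setT (density m) f.
Proof. by move=> /densityE; apply: filterS => x /= /(_ Logic.I)[]. Qed.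

Lemma has_density_expectation m f g c : has_density m f ->
  measurable_fun setT g -> (forall x, `|g x| <= c) ->
  (\int[m]_x (g x)%:E)%E = (\int[leb]_x (g x * f x))%:E.
Proof.
move=> mf mg gc; have [f_meas f0 fE] := mf.
have dom : m `<< leb.
  apply/null_content_dominatesP => A mA A0.
  rewrite fE//; apply: null_set_integral => //.
  exact/measurable_EFinP/measurable_funTS.
have intg : m.-integrable setT (EFin \o g).
  apply: measurable_bounded_integrable => //.
    by apply: (le_lt_trans (probability_le1 m measurableT)); rewrite ltry.
  exists c; split; first exact: num_real.
  by move=> e ce x _; exact: le_trans (gc x) (ltW ce).
rewrite -(Radon_Nikodym_change_of_variables dom measurableT intg).
rewrite /Rintegral fineK; last first.
  apply: integrable_fin_num => //.
  apply: (dominated_integrable (has_density_integrable mf)).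
    exact: measurable_funM.
  by exists c => x; rewrite normrM ler_pM// ger0_norm.
apply: ae_eq_integral => //.
- apply: emeasurable_funM; first exact/measurable_EFinP.
  exact: measurable_int (Radon_Nikodym_integrable _).
- exact/measurable_EFinP/measurable_funM.
- have dom' : charge_of_finite_measure m `<< leb by exact: dom.
  apply: filterS (densityE mf) => x /= H xT; rewrite EFinM -H//.
  by rewrite /density fineK// Radon_Nikodym_fin_num.
Qed.

(** The identity 1 / x = x (x^2)^(-1) reduces inversion to real powers of
nonnegative numbers. *)
Lemma measurable_invr : measurable_fun [set: R] (@GRing.inv R).
Proof.
have -> : @GRing.inv R = fun x => x * (x ^+ 2) `^ (-1).
  apply/funext => x; rewrite powR_inv1 ?sqr_ge0//.
  have [->|x0] := eqVneq x 0; first by rewrite invr0 mul0r.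
  by rewrite expr2 invfM mulrA mulfV// mul1r.
apply: measurable_funM => //.
rewrite (_ : (fun x : R => _) = (@powR R ^~ (-1)) \o (fun x : R => x ^+ 2))//.
apply: measurableT_comp; [exact: measurable_powR|exact: measurable_funX].
Qed.

Lemma measurable_ln_ratio f p : measurable_fun setT f -> measurable_fun setT p ->
  measurable_fun setT (fun x => ln (f x / p x)).
Proof.
move=> mf mp; rewrite (_ : (fun x => _) = @ln R \o (f \* (@GRing.inv R \o p)))//.
apply: measurableT_comp; first exact: measurable_ln.
apply: measurable_funM => //; apply: measurableT_comp => //.
exact: measurable_invr.
Qed.

Lemma KLE m pi f p : has_density m f -> has_density pi p ->
  (KL m pi < +oo)%E -> KL m pi = (\int[leb]_x (ln (f x / p x) * f x)%:E)%E.
Proof.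
move=> mf pip; rewrite /KL; case: ifPn => // _ _.
have [f_meas _ _] := mf; have [p_meas _ _] := pip.
have mm := measurable_density m; have mpi := measurable_density pi.
apply: ae_eq_integral => //.
- by apply/measurable_EFinP/measurable_funM => //; exact: measurable_ln_ratio.
- by apply/measurable_EFinP/measurable_funM => //; exact: measurable_ln_ratio.
- move: (has_density_ae mf) (has_density_ae pip); apply: filterS2 => x.
  by move=> /(_ Logic.I) /= -> /(_ Logic.I) ->.
Qed.

(** From y - 1 <= y ln y at y = f / p, the integrand is at least f - p, whose
integral is 0. *)
Lemma KL_ge0 m pi f p : has_density m f -> has_density pi p ->
  (forall x, 0 < p x) -> (KL m pi < +oo)%E -> (0 <= KL m pi)%E.
Proof.
move=> mf pip p0 KLoo; rewrite (KLE mf pip KLoo).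
have intf := has_density_integrable mf; have intp := has_density_integrable pip.
have [f_meas f0 _] := mf; have [p_meas _ _] := pip.
have -> : 0%E = (\int[leb]_x (f x - p x)%:E)%E.
  rewrite [RHS](integralB measurableT intf intp).
  by rewrite (has_density_integral mf) (has_density_integral pip) subee.
apply: le_integral_integrable => [||x].
- exact: (integrableB measurableT intf intp).
- by apply: measurable_funM => //; exact: measurable_ln_ratio.
- have h0 : 0 <= f x / p x by rewrite divr_ge0// ltW.
  have := mulr_ln_ge h0; rewrite -(ler_pM2r (p0 x)) mulrBl mul1r divfK ?gt_eqF//.
  by rewrite mulrAC divfK ?gt_eqF// mulrC.
Qed.

End density.

(** A vanishing normalizing integral would make the density identically 0. *)
Lemma gibbs_gt0 {R : realType} {d : nat} (sigma : R) (U : Rd R d -> R)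
  (pi : Prob R d) : has_density pi (gibbs sigma U) -> forall x, 0 < gibbs sigma U x.
Proof.
move=> pi_gibbs x; rewrite /gibbs; set Z := (\int[_]_y _)%R.
have : 0 <= Z by apply: Rintegral_ge0 => y _; exact: expR_ge0.
rewrite le_eqVlt => /orP[/eqP Z0|Z0]; last by rewrite divr_gt0// expR_gt0.
have := has_density_integral pi_gibbs.
under eq_integral do rewrite /gibbs -/Z -Z0 invr0 mulr0.
by rewrite integral0 => /esym/eqP; rewrite onee_eq0.
Qed.

Lemma cvg_initial (S : choiceType) (T : topologicalType) (f : S -> T)
    (F : set_system S) (s : S) : Filter F ->
  f @ F --> f s -> F --> (s : initial_topology f).
Proof.
move=> FF fF A [_ [[B oB <-] Bs BA]]; apply: filterS BA _.
by apply: fF; exact: open_nbhs_nbhs.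
Qed.

Lemma cvg_weak_Prob {R : realType} {d : nat} (M : nat -> Prob R d) (m : Prob R d) :
  (forall f : bcont,
    \int[M n]_x (sval f x) @[n --> \oo] --> \int[m]_x (sval f x)) ->
  (M n : weak_Prob) @[n --> \oo] --> (m : weak_Prob).
Proof.
move=> Mm; apply: cvg_initial; apply/cvg_sup => f.
apply: cvg_initial; exact: Mm.
Qed.

(** * Derivative of the energy along the flow *)

Section energy.
Context {R : realType} {d : nat}.
Variables (sigma : R) (F : Prob R d -> R) (dF : Prob R d -> Rd R d -> R).
Variables (p rho0 : Rd R d -> R) (pi m0 : Prob R d) (B C : R).
Variables (m : R -> Prob R d) (rho : R -> Rd R d -> R).
Hypothesis sigma_gt0 : 0 < sigma.
Hypothesis F_flat : flat_derivative F dF.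
Hypothesis F_convex : flat_convex F dF.
Hypothesis dF_le : forall mu x, `|dF mu x| <= C.
Hypothesis pi_p : has_density pi p.
Hypothesis p_gt0 : forall x, 0 < p x.
Hypothesis rho0_le : forall x, rho0 x / p x <= B.
Hypothesis m_sol : is_solution sigma dF pi p m0 rho0 m rho.

Local Notation leb := (@lebesgue_Rd R d).
Let s : R := sigma ^+ 2 / 2.
Let k t := fine (KL (m t) pi).
Let h t x := rho t x / p x.
Let phi t x := ln (rho t x / p x) * rho t x.
Let drho t x := - drift sigma dF pi p (m t) (rho t) x * rho t x.

Let s_gt0 : 0 < s. Proof. by rewrite divr_gt0// exprn_gt0. Qed.

Let rho_density t : 0 <= t -> has_density (m t) (rho t).
Proof. by case: m_sol => _ _ + _ _; apply. Qed.

Let rho_deriv t x : 0 <= t -> is_derive0y (rho^~ x) t (drho t x).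
Proof. by case: m_sol => _ _ _ _ + t0; apply. Qed.

Arguments rho_deriv {t} x _.

Let KL_lt t : 0 <= t -> (KL (m t) pi < +oo)%E.
Proof. by case: m_sol => _ _ _ + _; apply. Qed.

Let rhoE t x : rho t x = h t x * p x.
Proof. by rewrite /h divfK// gt_eqF. Qed.

Let phiE t x : phi t x = p x * (h t x * ln (h t x)).
Proof. by rewrite /phi -/(h t x) rhoE; ring. Qed.

(** The nonnegativity of the relative entropy supplies the lower bound on k. *)
Lemma solution_log_flow : log_flow s C B k (fun t => dF (m t)) h.
Proof.
have [_ rho00 _ _ _] := m_sol.
have h_ge0 t x : 0 <= t -> 0 <= h t x.
  move=> t0; have [_ + _] := rho_density t0.
  by move=> r0; rewrite divr_ge0// ltW.
split => //.
- move=> t t0; rewrite fine_ge0//.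
  exact: KL_ge0 (rho_density t0) pi_p p_gt0 (KL_lt t0).
- move=> x t t0; have := is_derive0yZ (c := (p x)^-1) t0 (rho_deriv x t0).
  rewrite (_ : (fun r => _) = h^~ x); last first.
    by apply/funext => r; rewrite /h mulrC.
  congr is_derive0y; rewrite /drho /drift -/s -/(k t) -/(h t x) /h.
  by rewrite mulrCA mulrA mulrA mulrAC; congr (_ * _); rewrite mulrC mulrA.
- by move=> x; rewrite /h rho00.
- apply: contrapT => /forallNP nh.
  have /eqP := has_density_integral (rho_density (lexx 0)).
  rewrite (eq_integral (cst 0%E)); last first.
    move=> x _; congr EFin; rewrite rhoE.
    have -> : h 0 x = 0; last by rewrite mul0r.
    by apply/eqP; rewrite eq_le h_ge0// andbT leNgt; apply/negP/nh.
  by rewrite integral0 eq_sym onee_eq0.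
Qed.

Let flow := solution_log_flow.

Let leb_p := has_density_integrable pi_p.

Let rho_meas t : 0 <= t -> measurable_fun setT (rho t).
Proof. by move=> t0; have [] := rho_density t0. Qed.

Let phi_meas t : 0 <= t -> measurable_fun setT (phi t).
Proof.
move=> t0; have [p_meas _ _] := pi_p.
apply: measurable_funM; last exact: rho_meas.
by apply: measurable_ln_ratio => //; exact: rho_meas.
Qed.

Let size_bound b : exists2 L, 0 <= L & forall t x, 0 <= t <= b ->
  `|rho t x| <= L * p x /\ `|phi t x| <= L * p x.
Proof.
have [M M0 hM] := flow_bounded flow b.
exists (M + (1 + M ^+ 2)); first by rewrite !addr_ge0// sqr_ge0.
move=> t x tb; have /andP[t0 _] := tb; have ht := flow_ge0 flow x t0.
have px := p_gt0 x; have hMx := hM t x tb; split.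
  rewrite rhoE normrM (gtr0_norm px) ler_pM2r// ger0_norm//.
  by have := sqr_ge0 M; lra.
rewrite phiE normrM (gtr0_norm px) mulrC ler_pM2r//.
apply: le_trans (normr_mulr_ln ht) _.
have : h t x ^+ 2 <= M ^+ 2 by rewrite ler_sqr ?nnegrE.
by lra.
Qed.

Let phi_integrable t : 0 <= t -> leb.-integrable setT (EFin \o phi t).
Proof.
move=> t0; have [L _ hL] := size_bound t.
apply: (dominated_integrable leb_p); first exact: phi_meas.
by exists L => x; have [] := hL t x; rewrite ?t0 ?lexx.
Qed.

Let KL_phi t : 0 <= t -> KL (m t) pi = (\int[leb]_x phi t x)%:E.
Proof.
move=> t0; rewrite (KLE (rho_density t0) pi_p (KL_lt t0)) /Rintegral fineK//.
exact: integrable_fin_num (phi_integrable t0).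
Qed.

Let k_phi t : 0 <= t -> k t = \int[leb]_x phi t x.
Proof. by move=> t0; rewrite /k KL_phi. Qed.

Let k_bound b : exists K, forall t, 0 <= t <= b -> k t <= K.
Proof.
have [L L0 hL] := size_bound b; exists (\int[leb]_x (L * p x)) => t tb.
have /andP[t0 _] := tb; rewrite k_phi//; apply: le_Rintegral => //.
- exact: phi_integrable.
- exact: (integrableZl measurableT L leb_p).
- by move=> x _; have [_] := hL t x tb; apply: le_trans; exact: ler_norm.
Qed.

(** This is the domination that allows differentiation under the integral. *)
Lemma solution_lipschitz b : exists2 L, 0 <= L &
  forall r t x, 0 <= r <= b -> 0 <= t <= b ->
    `|rho r x - rho t x| <= L * `|r - t| * p x /\
    `|phi r x - phi t x| <= L * `|r - t| * p x.
Proof.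
have [K kK] := k_bound b.
have [L L0 hL] := flow_lipschitz flow kK; exists L => // r t x rb tb.
have [h1 h2] := hL x r t rb tb; have px := p_gt0 x.
split; first by rewrite !rhoE -mulrBl normrM (gtr0_norm px) ler_pM2r.
by rewrite !phiE -mulrBr normrM (gtr0_norm px) mulrC ler_pM2r.
Qed.

Let phi_deriv t x : 0 <= t ->
  is_derive0y (phi^~ x) t ((ln (h t x) + 1) * drho t x).
Proof.
move=> t0; have := is_derive0yZ (c := p x) t0 (flow_is_derive_entropy flow (x := x) t0).
rewrite (_ : (fun r => p x * _) = phi^~ x); last first.
  by apply/funext => r; rewrite phiE.
congr is_derive0y; rewrite /drho /drift -/s -/(k t) -/(h t x) rhoE.
by ring.
Qed.
Arguments phi_deriv {t} x _.

Let size_integrable (g : Rd R d -> R) (c t : R) :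
  measurable_fun setT g -> (forall x, `|g x| <= c) ->
  0 <= t -> leb.-integrable setT (EFin \o (fun x => g x * rho t x)).
Proof.
move=> mg gc t0; have [_ r0 _] := rho_density t0.
apply: (dominated_integrable (has_density_integrable (rho_density t0))).
  by apply: measurable_funM => //; exact: rho_meas.
by exists c => x; rewrite normrM ler_pM// ger0_norm.
Qed.

Let rho_cvg t (u : R^nat) x : 0 <= t -> (forall n, 0 <= u n <= t + 1) ->
  u @ \oo --> t -> rho (u n) x @[n --> \oo] --> rho t x.
Proof.
move=> t0 u0 ut; have [L L0 hL] := solution_lipschitz (t + 1).
have tt : 0 <= t <= t + 1 by rewrite t0 lerDl ler01.
apply/cvgrPdist_le => e e0; move/cvgrPdist_le : ut.
have Lp : 0 < L * p x + 1 by rewrite ltr_wpDl// mulr_ge0// ltW.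
move=> /(_ _ (divr_gt0 e0 Lp)); apply: filterS => n.
rewrite ler_pdivlMr// => une; apply: le_trans une.
have [+ _] := hL t (u n) x tt (u0 n); move/le_trans; apply.
by have := normr_ge0 (t - u n); nra.
Qed.

(** The densities converge pointwise under a common multiple of p, so the
measures converge weakly. *)
Lemma solution_dF_cvg t (u : R^nat) x : 0 <= t -> (forall n, 0 <= u n <= t + 1) ->
  u @ \oo --> t -> dF (m (u n)) x @[n --> \oo] --> dF (m t) x.
Proof.
move=> t0 u0 ut; have [dF_cont _ _ _ _] := F_flat.
apply: (@cvg_comp _ _ _ (fun n => m (u n) : weak_Prob) (fun mu => dF mu x)
  _ _ _ _ (dF_cont x (m t))).
apply: cvg_weak_Prob => -[f [f_cont [M fM]]] /=.
have f_meas : measurable_fun [set: Rd R d] f.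
  apply: (measurability _ (measurable_realfun.RGenOpens.measurableE R)).
  move=> _ [_ [a [b ->] <-]]; rewrite setTI; apply: sub_sigma_algebra.
  by have /continuousP := f_cont; apply; exact: interval_open.
have fE r : 0 <= r -> \int[m r]_y f y = \int[leb]_y (f y * rho r y).
  move=> r0; rewrite [LHS]/Rintegral.
  by rewrite (has_density_expectation (rho_density r0) f_meas fM).
have un_ge0 n : 0 <= u n by have /andP[] := u0 n.
rewrite fE// (_ : (fun n => _) = (fun n => \int[leb]_y (f y * rho (u n) y))); last first.
  by apply/funext => n; rewrite fE.
have [L L0 hL] := size_bound (t + 1).
have M0 : 0 <= M by apply: le_trans (fM 0); exact: normr_ge0.
have [] := @dominated_cvg_Rintegral _ _ _ leb
  (fun n y => f y * rho (u n) y) (fun y => f y * rho t y) p (M * L) leb_p => //.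
- by move=> n; apply: measurable_funM => //; exact: rho_meas.
- move=> n y; rewrite normrM -mulrA; apply: ler_pM => //.
  by have [] := hL (u n) y (u0 n).
- move=> y; apply: cvgMl_tmp; exact: rho_cvg.
Qed.

Let flow_V r := F (m r) + s * k r.

(** An instance of convexity; exchanging t and r gives the lower bound
on the increment of F. *)
Let le_F t r : 0 <= t -> 0 <= r -> F (m r) - F (m t) <=
  \int[leb]_x (dF (m r) x * rho r x) - \int[leb]_x (dF (m r) x * rho t x).
Proof.
move=> t0 r0; have [_ dF_meas _ _ _] := F_flat.
have := F_convex (m r) (m t).
rewrite (has_density_expectation (rho_density r0) (dF_meas _) (dF_le _)).
by rewrite (has_density_expectation (rho_density t0) (dF_meas _) (dF_le _)).
Qed.

(** Used with g = dF(m_t), g = dF(m_r), and with g = 1 to see that difference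
quotients of densities integrate to 0. *)
Let quotient_integral (t r : R) (g : Rd R d -> R) (c : R) : 0 <= t -> 0 <= r ->
  measurable_fun setT g -> (forall x : Rd R d, `|g x| <= c) ->
  \int[leb]_x (g x * ((rho r x - rho t x) / (r - t))) =
  (\int[leb]_x (g x * rho r x) - \int[leb]_x (g x * rho t x)) / (r - t).
Proof.
move=> t0 r0 mg gc.
have ir := size_integrable mg gc r0; have it := size_integrable mg gc t0.
rewrite -RintegralB// -RintegralZr//; last exact: (integrableB measurableT ir it).
by apply: eq_Rintegral => x _; rewrite mulrA mulrBr.
Qed.

Lemma energy_is_derive t : 0 <= t ->
  leb.-integrable setT (EFin \o
    (fun x => `|drift sigma dF pi p (m t) (rho t) x| ^+ 2 * rho t x)) /\
  is_derive0y flow_V t (- \int[leb]_x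
    (`|drift sigma dF pi p (m t) (rho t) x| ^+ 2 * rho t x)).
Proof.
move=> t0; have [_ dF_meas _ _ _] := F_flat.
have tt : 0 <= t <= t + 1 by rewrite t0 lerDl ler01.
have [L L0 hL] := solution_lipschitz (t + 1).
pose q r x := (rho r x - rho t x) / (r - t).
pose w r x := (phi r x - phi t x) / (r - t).
have q_meas r : 0 <= r -> measurable_fun setT (q r).
  by move=> r0; apply: measurable_funM => //; apply: measurable_funB; exact: rho_meas.
have w_meas r : 0 <= r -> measurable_fun setT (w r).
  by move=> r0; apply: measurable_funM => //; apply: measurable_funB; exact: phi_meas.
have q_le r x : 0 <= r <= t + 1 -> r != t -> `|q r x| <= L * p x.
  move=> r01 rt; rewrite normrM normfV ler_pdivrMr ?normr_gt0 ?subr_eq0//.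
  by rewrite mulrAC; have [] := hL r t x r01 tt.
have w_le r x : 0 <= r <= t + 1 -> r != t -> `|w r x| <= L * p x.
  move=> r01 rt; rewrite normrM normfV ler_pdivrMr ?normr_gt0 ?subr_eq0//.
  by rewrite mulrAC; have [] := hL r t x r01 tt.
pose D x := drift sigma dF pi p (m t) (rho t) x.
(* The multiple of int q = 0 that completes dF + s (ln h + 1) to the drift. *)
have [e eE] : exists e, e = s + s * k t by exists (s + s * k t).
pose G r x := dF (m t) x * q r x + s * w r x - e * q r x.
have G_cvg (u : R^nat) : (forall n, 0 <= u n <= t + 1) -> (forall n, u n != t) ->
    u @ \oo --> t ->
    leb.-integrable setT (EFin \o (fun x => - (`|D x| ^+ 2 * rho t x))) /\
    \int[leb]_x (G (u n) x) @[n --> \oo] -->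
      \int[leb]_x (- (`|D x| ^+ 2 * rho t x)).
  move=> u01 unt ut; have u0 n : 0 <= u n by have /andP[] := u01 n.
  apply: (dominated_cvg_Rintegral (c := C * L + s * L + `|e| * L) leb_p).
  - move=> n; apply: measurable_funB; last by apply: measurable_funM => //; exact: q_meas.
    apply: measurable_funD; last by apply: measurable_funM => //; exact: w_meas.
    by apply: measurable_funM => //; exact: q_meas.
  - move=> n x; apply: le_trans (ler_normB _ _) _; rewrite !mulrDl; apply: lerD; last first.
      by rewrite normrM -mulrA ler_pM// q_le.
    apply: le_trans (ler_normD _ _) _; apply: lerD; rewrite normrM -mulrA.
      by rewrite ler_pM// q_le.
    by rewrite gtr0_norm// ler_pM// ?w_le// ltW.
  - move=> x; have q_cvg := is_derive0y_cvgn (rho_deriv x t0) u0 unt ut.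
    have w_cvg := is_derive0y_cvgn (phi_deriv x t0) u0 unt ut.
    have -> : - (`|D x| ^+ 2 * rho t x) = dF (m t) x * drho t x +
        s * ((ln (h t x) + 1) * drho t x) - e * drho t x.
      rewrite real_normK ?num_real// /drho -/(D x) eE.
      have -> : ln (h t x) = (D x - dF (m t) x + s * k t) / s.
        by rewrite /D /drift -/s -/(k t) -/(h t x); field; rewrite gt_eqF.
      by field; rewrite gt_eqF.
    by apply: cvgB; [apply: cvgD|]; apply: cvgMl_tmp.
have G_int r : 0 <= r <= t + 1 -> r != t -> \int[leb]_x G r x =
    \int[leb]_x (dF (m t) x * q r x) + s * ((k r - k t) / (r - t)).
  move=> r01 rt; have /andP[r0 _] := r01.
  have iq : leb.-integrable setT (EFin \o q r).
    by apply: (dominated_integrable leb_p (q_meas r r0)); exists L => x; exact: q_le.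
  have iw : leb.-integrable setT (EFin \o w r).
    by apply: (dominated_integrable leb_p (w_meas r r0)); exists L => x; exact: w_le.
  have iaq : leb.-integrable setT (EFin \o (fun x => dF (m t) x * q r x)).
    apply: (dominated_integrable leb_p).
      by apply: measurable_funM => //; exact: q_meas.
    by exists (C * L) => x; rewrite normrM -mulrA ler_pM// q_le.
  have isw := integrableZl measurableT s iw.
  have ieq := integrableZl measurableT e iq.
  rewrite RintegralB//; last exact: (integrableD measurableT iaq isw).
  rewrite RintegralD// !RintegralZl//.
  have -> : \int[leb]_x q r x = 0.
    have one_le (x : Rd R d) : `|cst 1 x : R| <= 1 by rewrite normr1.
    have E g : \int[leb]_x (cst 1 x * g x) = \int[leb]_x g x.
      by apply: eq_Rintegral => x _; rewrite mul1r.
    have := quotient_integral t0 r0 (measurable_cst _) one_le.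
    rewrite !E => ->.
    rewrite /Rintegral (has_density_integral (rho_density r0)).
    by rewrite (has_density_integral (rho_density t0)) subrr mul0r.
  rewrite mulr0 subr0; congr (_ + s * _).
  have ir := phi_integrable r0; have it := phi_integrable t0.
  rewrite RintegralZr//; last exact: (integrableB measurableT ir it).
  by rewrite RintegralB// -!k_phi.
(* Convexity pins the quotient of F between two integrals whose difference is
   the integral on the right. *)
have V_le r : 0 <= r <= t + 1 -> r != t ->
    `|(flow_V r - flow_V t) / (r - t) - \int[leb]_x G r x| <=
    `|\int[leb]_x ((dF (m r) x - dF (m t) x) * q r x)|.
  move=> r01 rt; have /andP[r0 _] := r01.
  have rt0 : r - t != 0 by rewrite subr_eq0.
  rewrite G_int//.
  have -> : \int[leb]_x ((dF (m r) x - dF (m t) x) * q r x) =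
     \int[leb]_x (dF (m r) x * q r x) - \int[leb]_x (dF (m t) x * q r x).
    rewrite -RintegralB//; first by apply: eq_Rintegral => x _; rewrite mulrBl.
    + apply: (dominated_integrable leb_p).
        by apply: measurable_funM => //; exact: q_meas.
      by exists (C * L) => x; rewrite normrM -mulrA ler_pM// q_le.
    + apply: (dominated_integrable leb_p).
        by apply: measurable_funM => //; exact: q_meas.
      by exists (C * L) => x; rewrite normrM -mulrA ler_pM// q_le.
  rewrite !(quotient_integral t0 r0 (dF_meas _) (dF_le _)) -mulrBl normrM.
  have := le_F t0 r0; have := le_F r0 t0; rewrite -opprB.
  set Y := \int[leb]_x (dF (m t) x * rho r x) - _.
  set X := \int[leb]_x (dF (m r) x * rho r x) - _ => FY FX.
  have -> : (flow_V r - flow_V t) / (r - t) -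
      (Y / (r - t) + s * ((k r - k t) / (r - t))) =
      (F (m r) - F (m t) - Y) / (r - t) by rewrite /flow_V; field.
  by rewrite normrM ler_wpM2r// !ger0_norm; lra.
(* Dominated convergence along any admissible sequence makes the limit integrable. *)
have iD : leb.-integrable setT (EFin \o (fun x => `|D x| ^+ 2 * rho t x)).
  pose u (n : nat) : R := t + n.+1%:R^-1.
  have [|||iN _] := G_cvg u.
  - move=> n; rewrite addr_ge0//= lerD2l invf_le1// ler1n //.
  - by move=> n; rewrite /u -subr_eq0 addrAC subrr add0r invr_eq0 pnatr_eq0.
  - by rewrite -[X in _ --> X]addr0; apply: cvgD; [exact: cvg_cst|exact: cvg_harmonic].
  have := integrableN iN; apply: eq_integrable => // x _.
  by rewrite /= opprK.
split => //; apply: cvgn_is_derive0y => // u u01 unt ut.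
have u0 n : 0 <= u n by have /andP[] := u01 n.
have [_ G_lim] := G_cvg u u01 unt ut.
have E_lim : \int[leb]_x ((dF (m (u n)) x - dF (m t) x) * q (u n) x)
    @[n --> \oo] --> (0 : R).
  have [|||_] := @dominated_cvg_Rintegral _ _ _ leb
    (fun n x => (dF (m (u n)) x - dF (m t) x) * q (u n) x)
    (fun x => (dF (m t) x - dF (m t) x) * drho t x) p (2 * C * L) leb_p.
  - move=> n; apply: measurable_funM; last exact: q_meas.
    exact: measurable_funB.
  - move=> n x; rewrite normrM -mulrA ler_pM ?q_le//.
    by apply: le_trans (ler_normB _ _) _; rewrite mulr_natl mulr2n lerD.
  - move=> x; apply: cvgM; last first.
      exact: is_derive0y_cvgn (rho_deriv x t0) u0 unt ut.
    by apply: cvgB; [exact: solution_dF_cvg|exact: cvg_cst].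
  rewrite [X in _ --> X](_ : _ = 0)//.
  rewrite /Rintegral (eq_integral (cst 0%E)) ?integral0// => x _.
  by rewrite subrr mul0r.
have -> : - (\int[leb]_x (`|D x| ^+ 2 * rho t x)) =
    \int[leb]_x (- (`|D x| ^+ 2 * rho t x)).
  rewrite -mulN1r -RintegralZl//; by apply: eq_Rintegral => x _; rewrite mulN1r.
apply/cvgrPdist_lt => e' e'0.
have e2 : 0 < e' / 2 by rewrite divr_gt0.
move/cvgrPdist_lt : G_lim => /(_ _ e2); move/cvgrPdist_lt : E_lim => /(_ _ e2).
apply: filterS2 => n; rewrite sub0r normrN => En Gn.
set V := (_ / _); have := ler_distD (\int[leb]_x G (u n) x)
  (\int[leb]_x (- (`|D x| ^+ 2 * rho t x))) V.
move/le_lt_trans; apply; rewrite (splitr e') ltrD//.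
by rewrite distrC; apply: le_lt_trans En; exact: V_le.
Qed.

Lemma solution_KL_fin_num t : 0 <= t -> KL (m t) pi \is a fin_num.
Proof. by move=> t0; rewrite KL_phi. Qed.

End energy.

Theorem theorem2p2 (R : realType) (d : nat) (sigma : R)
    (F : Prob R d -> R) (dF : Prob R d -> Rd R d -> R)
    (d2F : Prob R d -> Rd R d -> Rd R d -> R)
    (U : Rd R d -> R) (pi : Prob R d)
    (m0 : Prob R d) (rho0 : Rd R d -> R) (B : R)
    (m : R -> Prob R d) (rho : R -> Rd R d -> R)
    (sigma_gt0 : 0 < sigma)
    (F_flat : flat_derivative F dF)
    (F_flat2 : second_flat_derivative dF d2F)
    (F_convex : flat_convex F dF)
    (dF_bounded : exists C : R,
       0 < C /\ forall (mu : Prob R d) (x : Rd R d), `|dF mu x| <= C)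
    (d2F_bounded : exists C2 : R,
       0 < C2 /\ forall (mu : Prob R d) (x y : Rd R d), `|d2F mu x y| <= C2)
    (pi_gibbs : has_density pi (gibbs sigma U))
    (m0_density : has_density m0 rho0)
    (B_gt1 : 1 < B)
    (m0_bound : forall x : Rd R d, rho0 x / gibbs sigma U x <= B)
    (m_solution : is_solution sigma dF pi (gibbs sigma U) m0 rho0 m rho) :
  forall t : R, 0 <= t ->
    Vsigma sigma F pi (m t) \is a fin_num /\
    exists l : R,
      l%:E = (- \int[lebesgue_Rd]_x
                (`|drift sigma dF pi (gibbs sigma U) (m t) (rho t) x| ^+ 2
                   * rho t x)%:E)%E /\
      is_derive0y (fun s => fine (Vsigma sigma F pi (m s))) t l.
Proof.
have [C [_ dF_le]] := dF_bounded.
have p_gt0 := gibbs_gt0 pi_gibbs.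
have KL_fin := solution_KL_fin_num sigma_gt0 dF_le pi_gibbs p_gt0 m0_bound m_solution.
have V_fin r : 0 <= r -> Vsigma sigma F pi (m r) =
    (F (m r) + sigma ^+ 2 / 2 * fine (KL (m r) pi))%:E.
  by move=> r0; rewrite /Vsigma -{1}(fineK (KL_fin r r0)) -EFinM -EFinD.
move=> t t0; split; first by rewrite V_fin.
have [iD V_deriv] := energy_is_derive sigma_gt0 F_flat F_convex dF_le pi_gibbs
  p_gt0 m0_bound m_solution t0.
eexists; split; last first.
  apply/is_derive0y_ext => //.
  have [g gV gt] := (is_derive0y_ext _ _ t0).1 V_deriv.
  by exists g => [r r0|]; [rewrite gV// V_fin|exact: gt].
by rewrite EFinN /Rintegral fineK//; exact: integrable_fin_num.
Qed.
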